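(* Let $n$ be an even positive integer and let $K_{n,n}$ be the complete bipartite graph with both parts of size $n$. Then no nonzero real number is a root of the domination polynomial $D(K_{n,n},x)$.
   Context: For a simple graph $G=(V,E)$, a set $S\subseteq V$ is dominating if every vertex of $V\setminus S$ is adjacent to at least one vertex of $S$. Writing $d(G,i)$ for the number of dominating sets of $G$ of cardinality $i$ and $\gamma(G)$ for the minimum cardinality of a dominating set, the domination polynomial is $D(G,x)=\sum_{i=\gamma(G)}^{|V|} d(G,i)x^i$. A root of $D(G,x)$ is called a domination root of $G$. *)

(* Defs.v *)
From HB Require Import structures.
From mathcomp Require Import all_boot all_order all_algebra.
From mathcomp Require Import reals.

Set Implicit Arguments.
Unset Strict Implicit.
Unset Printing Implicit Defensive.

Import GRing.Theory.
Local Open Scope ring_scope.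

Record sgraph := SGraph {
  vertex :> finType;
  edge : rel vertex;
  edge_sym : symmetric edge;
  edge_irrefl : irreflexive edge }.

Definition dominating (G : sgraph) (S : {set G}) : bool :=
  [forall v : G, (v \notin S) ==> [exists u : G, (u \in S) && edge v u]].

Lemma dominating_setT (G : sgraph) : dominating [set: G].
Proof. by apply/forallP => v; rewrite inE. Qed.

Definition num_dominating (G : sgraph) (i : nat) : nat :=
  #|[set S : {set G} | dominating S & #|S| == i]|.

(* [arg min] needs one set satisfying the condition: the whole vertex set
   does, by dominating_setT. *)
Definition domination_number (G : sgraph) : nat :=
  #|[arg min_(S < [set: G] | dominating S) #|S|]|.

Definition domination_poly (R : nzRingType) (G : sgraph) : {poly R} :=
  \sum_(domination_number G <= i < #|G|.+1) (num_dominating G i)%:R *: 'X^i.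

Definition complete_bipartite_edge (m n : nat) : rel ('I_m + 'I_n)%type :=
  fun u v => match u, v with
             | inl _, inr _ | inr _, inl _ => true
             | _, _ => false
             end.

Lemma complete_bipartite_sym m n : symmetric (@complete_bipartite_edge m n).
Proof. by move=> [u|u] [v|v]. Qed.

Lemma complete_bipartite_irrefl m n :
  irreflexive (@complete_bipartite_edge m n).
Proof. by move=> [u|u]. Qed.

Definition complete_bipartite (m n : nat) : sgraph :=
  SGraph (@complete_bipartite_sym m n) (@complete_bipartite_irrefl m n).

(* Main.v *)
(** A set dominates [K_{m,n}] iff it meets both parts or equals one of them, so
    [D(K_{n,n}, x) = s ^+ 2 + 2 x ^+ n] where [s] sums [x ^+ #|A|] over the
    nonempty subsets [A] of a part.  For even [n] and real [x != 0] the first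
    term is nonnegative and the second is positive. *)
Require Import Defs.
From HB Require Import structures.
From mathcomp Require Import all_boot all_order all_algebra.
From mathcomp Require Import reals.

Import Order.TTheory GRing.Theory Num.Theory.

Local Open Scope ring_scope.

Lemma domination_number_le (G : sgraph) (S : {set G}) :
  dominating S -> (domination_number G <= #|S|)%N.
Proof.
rewrite /domination_number.
by case: arg_minnP => [|T _ min_T /min_T //]; apply: dominating_setT.
Qed.

(** After exchanging the sums over sizes and sets, a dominating [S] contributes only at [i = #|S|].
    This index is in range: [domination_number_le] bounds it below and [max_card] above. *)
Lemma domination_polyE (R : nzRingType) (G : sgraph) :
  domination_poly R G = \sum_(S : {set G} | dominating S) 'X^#|S|.
Proof.
have termE i : (num_dominating G i)%:R *: 'X^i =
    \sum_(S : {set G} | dominating S && (i == #|S|)) 'X^i :> {poly R}.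
  rewrite sumr_const scaler_nat; congr (_ *+ _).
  by apply: eq_card => S; rewrite !inE eq_sym.
rewrite /domination_poly; under eq_bigr do rewrite termE.
rewrite (exchange_big_dep (@dominating G)) /=; last by move=> i S _ /andP[].
apply: eq_bigr => S domS; under eq_bigl do rewrite domS /=.
by rewrite big_nat1_eq domination_number_le // ltnS max_card.
Qed.

(** Vertex sets of the bipartite graph are handled as pairs of traces on the two parts, so that sums
    over them factor. *)
Definition sum_set {T U : finType} (AB : {set T} * {set U}) : {set T + U} :=
  [set u | match u with inl a => a \in AB.1 | inr b => b \in AB.2 end].

Lemma sum_set_bij (T U : finType) : bijective (@sum_set T U).
Proof.
exists (fun S : {set T + U} => (inl @^-1: S, inr @^-1: S)) => [[A B]|S].
  by congr pair; apply/setP=> a; rewrite !inE.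
by apply/setP=> -[a|b]; rewrite !inE.
Qed.

Lemma card_sum_set (T U : finType) (AB : {set T} * {set U}) :
  #|sum_set AB| = (#|AB.1| + #|AB.2|)%N.
Proof.
rewrite -!sum1_card big_sumType /=.
by congr addn; apply: eq_bigl => a; rewrite !inE.
Qed.

Lemma set0_eq_setT_ord (k : nat) :
  (0 < k)%N -> (set0 == [set: 'I_k]) = false.
Proof. by case: k => // k _; rewrite eq_sym -cards_eq0 cardsT card_ord. Qed.

Lemma dominating_complete_bipartite (m n : nat)
    (AB : {set 'I_m} * {set 'I_n}) : (0 < m)%N -> (0 < n)%N ->
  @dominating (complete_bipartite m n) (sum_set AB) =
    [|| (AB.1 != set0) && (AB.2 != set0), AB == (set0, setT)
      | AB == (setT, set0)].
Proof.
case: AB => A B m_gt0 n_gt0; rewrite !xpair_eqE /=.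
(* A left vertex outside [A] is adjacent exactly to the right vertices, so it is dominated iff [B]
   is nonempty; symmetrically for the right part. *)
have -> : @dominating (complete_bipartite m n) (sum_set (A, B)) =
    ((B != set0) || (A == setT)) && ((A != set0) || (B == setT)).
  apply/forallP/andP => [dom|[domA domB] [a|b]]; last 2 first.
  - rewrite inE /=; apply/implyP => aA; apply/existsP.
    case/orP: domA => [/set0Pn[b bB]|/eqP AT];
      first by exists (inr b); rewrite inE /= bB.
    by rewrite AT inE in aA.
  - rewrite inE /=; apply/implyP => bB; apply/existsP.
    case/orP: domB => [/set0Pn[a aA]|/eqP BT];
      first by exists (inl a); rewrite inE /= aA.
    by rewrite BT inE in bB.
  split; rewrite -implyNb negbK; apply/implyP => /eqP E; apply/eqP/setP => a;
    rewrite inE; apply/negPn/negP => aS.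
  - have := dom (inl a); rewrite inE /= aS /= => /existsP[[b|b]] /andP[] //.
    by rewrite inE /= E inE.
  - have := dom (inr a); rewrite inE /= aS /= => /existsP[[b|b]] /andP[] //.
    by rewrite inE /= E inE.
(* What remains is Boolean; positivity of [m] and [n] keeps [set0] distinct from [setT]. *)
have [->|A0] := eqVneq A set0; have [->|B0] := eqVneq B set0;
  rewrite /= ?set0_eq_setT_ord ?andbT ?orbF //.
Qed.

Lemma domination_poly_complete_bipartite (R : comNzRingType) (m n : nat) :
  (0 < m)%N -> (0 < n)%N ->
  domination_poly R (complete_bipartite m n) =
    (\sum_(A : {set 'I_m} | A != set0) 'X^#|A|)
      * (\sum_(B : {set 'I_n} | B != set0) 'X^#|B|) + 'X^n + 'X^m.
Proof.
move=> m_gt0 n_gt0; rewrite domination_polyE.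
rewrite (reindex (@sum_set 'I_m 'I_n)) /=;
  last exact: onW_bij (sum_set_bij _ _).
rewrite (eq_bigl _ _ (fun AB =>
  dominating_complete_bipartite m n AB m_gt0 n_gt0)).
under eq_bigr do rewrite card_sum_set exprD.
(* The two pairs consisting of one whole part give ['X^n] and ['X^m]; the pairs left over have both
   components nonempty, and their sum is the product. *)
rewrite (bigD1 (set0, setT)) /=; last by rewrite !eqxx orbT.
rewrite (bigD1 (setT, set0)) /=; last first.
  by rewrite !eqxx !orbT xpair_eqE eq_sym set0_eq_setT_ord.
rewrite !cards0 !cardsT !card_ord expr0 mul1r mulr1.
rewrite -[RHS]addrA [RHS]addrC -[RHS]addrA; congr (_ + (_ + _)).
rewrite big_distrlr pair_big /=; apply: eq_bigl => -[A B] /=.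
rewrite !xpair_eqE; have [->|A0] := eqVneq A set0.
  by case: (B == setT); rewrite ?set0_eq_setT_ord ?andbF.
have [->|B0] /= := eqVneq B set0; last by rewrite andbF.
by case: (A == setT).
Qed.

Theorem theorem2p3 (R : realType) (n : nat) (n_gt0 : (0 < n)%N)
    (n_even : ~~ odd n) (x : R) (x_neq0 : x != 0) :
  ~~ root (domination_poly R (complete_bipartite n n)) x.
Proof.
(* Since the parts have equal size, the two factors coincide and form a square; nonvanishing is then
   obtained from strict positivity. *)
rewrite domination_poly_complete_bipartite // /root !hornerE -expr2 gt_eqF //.
have xn_gt0 : 0 < x ^+ n.
  by rewrite lt0r expf_neq0 // real_exprn_even_ge0 ?num_real.
by rewrite addr_gt0 // ltr_wpDl // sqr_ge0.
Qed.
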